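(* Let $G$ be a subgroup of the symmetric group $S_m$, let $V$ and $U$ be unitary spaces, and let $\mathfrak{X}$ be an irreducible unitary representation of $G$ over $U$. Then the generalized Cartesian symmetrizer $C_{\mathfrak{X}}=\frac{1}{|G|}\sum_{\sigma\in G}\mathfrak{X}(\sigma)\otimes Q(\sigma)$ is an orthogonal projection on $U\otimes \times^{m}V$.
   Context: A unitary space is a finite-dimensional complex vector space equipped with an inner product. A unitary representation of $G$ over $U$ is a group homomorphism from $G$ to the unitary operators on $U$. $\times^{m}V$ denotes the Cartesian product of $m$ copies of $V$ (with componentwise vector space operations). The complex vector space $U\otimes\times^{m}V$ (tensor product over $\mathbb{C}$) carries the induced inner product determined by $\langle u\otimes x^\times, v\otimes y^\times\rangle=\langle u,v\rangle\sum_{i=1}^m\langle x_i,y_i\rangle$ for $u,v\in U$, $x^\times=(x_1,\dots,x_m)$, $y^\times=(y_1,\dots,y_m)\in\times^{m}V$. For $\sigma\in G$, $Q(\sigma)$ is the linear operator on $\times^m V$ given by $Q(\sigma)(v_1,\dots,v_m)=(v_{\sigma^{-1}(1)},\dots,v_{\sigma^{-1}(m)})$. Permutations compose as functions: $(\sigma\tau)(i)=\sigma(\tau(i))$. *)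

(* Defs.v *)
From HB Require Import structures.
From mathcomp Require Import all_boot all_order all_fingroup all_algebra.
From mathcomp Require Import reals complex.

Set Implicit Arguments.
Unset Strict Implicit.
Unset Printing Implicit Defensive.

Import Order.TTheory GRing.Theory Num.Theory.
Local Open Scope ring_scope.

(* A unitary space is a vectType over a numClosedFieldType together with a    *)
(* form of type {dot V for conj}: linear in the first argument, conjugate-    *)
(* linear in the second, hermitian, positive definite.                        *)
Notation "{ 'inner' V }" := {dot V for Num.conj}
  (format "{ 'inner'  V }") : type_scope.

Section CartesianPower.
Variables (C : numClosedFieldType) (V : vectType C) (m : nat).

Definition cart_dot (dotV : {inner V}) (x y : {ffun 'I_m -> V}) : C :=
  \sum_i dotV (x i) (y i).

Section Dot.
Variable dotV : {inner V}.

Lemma cart_dot_bilinear :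
  bilinear_for (GRing.Scale.Law.clone _ _ *%R _)
    (GRing.Scale.Law.clone _ _ (Num.conj \; *%R) _) (cart_dot dotV).
Proof.
split=> [y|x] a u v; rewrite /cart_dot /= mulr_sumr -big_split /=;
  apply: eq_bigr => i _; rewrite !ffunE.
- by rewrite linearDl /= linearZl_LR.
- by rewrite linearDr /= linearZr_LR.
Qed.

HB.instance Definition _ :=
  bilinear_isBilinear.Build C {ffun 'I_m -> V} {ffun 'I_m -> V} C
    _ _ (cart_dot dotV) cart_dot_bilinear.

Lemma cart_dot_herm x y :
  cart_dot dotV x y = (-1) ^+ false * Num.conj (cart_dot dotV y x).
Proof.
rewrite /cart_dot expr0 mul1r rmorph_sum; apply: eq_bigr => i _ /=.
by rewrite hermC /= expr0 mul1r.
Qed.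

HB.instance Definition _ :=
  isHermitianSesquilinear.Build C {ffun 'I_m -> V} false Num.conj
    (cart_dot dotV) cart_dot_herm.

Lemma cart_dot_gt0 x : x != 0 -> 0 < cart_dot dotV x x.
Proof.
move=> xn0; have [i xi] : exists i, x i != 0.
  apply/existsP; apply: contraNT xn0 => /existsPn x0.
  by apply/eqP/ffunP => i; rewrite ffunE; apply/eqP/negbNE/x0.
rewrite /cart_dot (bigD1 i) //= ltr_wpDr ?dnorm_gt0 //.
by apply: sumr_ge0 => j _; apply: dnorm_ge0.
Qed.

HB.instance Definition _ :=
  isDotProduct.Build C {ffun 'I_m -> V} (cart_dot dotV) cart_dot_gt0.

End Dot.

Definition cart_perm_fun (s : 'S_m) (v : {ffun 'I_m -> V}) : {ffun 'I_m -> V} :=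
  [ffun i => v ((s^-1)%g i)].

Lemma cart_perm_fun_linear s : linear (cart_perm_fun s).
Proof. by move=> a u v; apply/ffunP=> i; rewrite !ffunE. Qed.

HB.instance Definition _ s :=
  GRing.isLinear.Build C {ffun 'I_m -> V} {ffun 'I_m -> V} _
    (cart_perm_fun s) (cart_perm_fun_linear s).

Definition cart_perm (s : 'S_m) : 'End({ffun 'I_m -> V}) :=
  linfun (cart_perm_fun s).

Lemma cart_permE s v i : cart_perm s v i = v ((s^-1)%g i).
Proof. by rewrite lfunE ffunE. Qed.

(* In MathComp (t * s) i = s (t i), so (t * s) is the functional composite    *)
(* of s after t.                                                              *)
Lemma cart_permM s t : cart_perm (t * s)%g = (cart_perm s \o cart_perm t)%VF.
Proof.
by apply/lfunP=> v; apply/ffunP=> i; rewrite comp_lfunE !cart_permE invMg permM.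
Qed.

End CartesianPower.

(* Tensor product of two finite-dimensional spaces, realised as the space of  *)
(* coordinate matrices: u (x) w is the matrix of products of coordinates.     *)
(* tensor_liftE and tensor_ext give its universal property.                   *)
Definition tensor (C : fieldType) (U W : vectType C) : Type :=
  'M[C]_(\dim {:U}, \dim {:W}).

HB.instance Definition _ (C : fieldType) (U W : vectType C) :=
  Vector.copy (tensor U W) 'M[C]_(\dim {:U}, \dim {:W}).

Section Tensor.
Variable C : fieldType.
Implicit Types U W Z : vectType C.

Definition basis_vec U (i : 'I_(\dim {:U})) : U := (vbasis {:U})`_i.

Definition tens U W (u : U) (w : W) : tensor U W :=
  \matrix_(i, j) (coord (vbasis {:U}) i u * coord (vbasis {:W}) j w).

Definition tens_row U W (i : 'I_(\dim {:U})) (t : tensor U W) : W :=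
  \sum_j t i j *: basis_vec j.

Lemma tens_bilinear U W :
  bilinear_for (GRing.Scale.Law.clone _ _ *:%R _)
    (GRing.Scale.Law.clone _ _ *:%R _) (@tens U W).
Proof.
split=> [w|u] a x y; apply/matrixP=> i j; rewrite !mxE linearP /=.
- by rewrite mulrDl mulrA.
- by rewrite mulrDr mulrCA.
Qed.

HB.instance Definition _ U W :=
  bilinear_isBilinear.Build C U W (tensor U W) _ _ (@tens U W)
    (tens_bilinear U W).

Lemma tens_row_linear U W i : linear (@tens_row U W i).
Proof.
move=> a x y; rewrite /tens_row scaler_sumr -big_split /=.
by apply: eq_bigr => j _; rewrite !mxE scalerDl scalerA.
Qed.

HB.instance Definition _ U W i :=
  GRing.isLinear.Build C (tensor U W) W _ (@tens_row U W i)
    (tens_row_linear i).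

Lemma tens_rowE U W i (u : U) (w : W) :
  tens_row i (tens u w) = coord (vbasis {:U}) i u *: w.
Proof.
rewrite [in RHS](coord_vbasis (memvf w)) scaler_sumr.
by apply: eq_bigr => j _; rewrite mxE scalerA.
Qed.

Lemma vec_sum_coord U (u : U) :
  u = \sum_i coord (vbasis {:U}) i u *: basis_vec i.
Proof. exact: coord_vbasis (memvf u). Qed.

Lemma coord_basis_vec U (i k : 'I_(\dim {:U})) :
  coord (vbasis {:U}) i (basis_vec k) = (k == i)%:R.
Proof. by rewrite coord_free ?(basis_free (vbasisP _)). Qed.

Lemma tens_sum U W (t : tensor U W) :
  t = \sum_i tens (basis_vec i) (tens_row i t).
Proof.
apply/matrixP=> i j; rewrite summxE (bigD1 i) //= big1 => [|k nki].
  rewrite addr0 mxE coord_basis_vec eqxx mul1r linear_sum (bigD1 j) //= big1.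
    by rewrite addr0 linearZ /= coord_basis_vec eqxx mulr1.
  by move=> l nlj; rewrite linearZ /= coord_basis_vec (negPf nlj) mulr0.
by rewrite mxE coord_basis_vec (negPf nki) mul0r.
Qed.

Lemma tensor_ext U W Z (f g : 'Hom(tensor U W, Z)) :
  (forall u w, f (tens u w) = g (tens u w)) -> f = g.
Proof.
move=> fg; apply/lfunP => t; rewrite [t]tens_sum !linear_sum.
by apply: eq_bigr => i _; apply: fg.
Qed.

(* The linear map on the tensor product induced by a bilinear map b.          *)
Definition tensor_lift U W Z (b : U -> W -> Z) : 'Hom(tensor U W, Z) :=
  linfun (fun t : tensor U W => \sum_i b (basis_vec i) (tens_row i t)).

Lemma tensor_liftE U W Z (b : {bilinear U -> W -> Z}) u w :
  tensor_lift b (tens u w) = b u w.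
Proof.
pose h (t : tensor U W) := \sum_i b (basis_vec i) (tens_row i t).
have h_lin : linear h.
  move=> a x y; rewrite /h scaler_sumr -big_split /=.
  by apply: eq_bigr => i _; rewrite linearP linearDr /= linearZr_LR.
pose hM := GRing.isLinear.Build C (tensor U W) Z _ h h_lin.
pose hL : {linear _ -> _} := HB.pack h hM.
rewrite /tensor_lift (lfunE hL) /= /h [u in RHS]vec_sum_coord linear_sumlz.
by apply: eq_bigr => i _; rewrite tens_rowE linearZr_LR linearZl_LR.
Qed.

(* The operator f (x) g.                                                      *)
Definition tensor_map U W (f : 'End(U)) (g : 'End(W)) : 'End(tensor U W) :=
  tensor_lift (fun u w => tens (f u) (g w)).

Lemma tensor_mapE U W (f : 'End(U)) (g : 'End(W)) u w :
  tensor_map f g (tens u w) = tens (f u) (g w).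
Proof.
pose b u w := tens (f u) (g w).
have b_bil : bilinear_for (GRing.Scale.Law.clone _ _ *:%R _)
    (GRing.Scale.Law.clone _ _ *:%R _) b.
  split=> [y|x] a v v'; rewrite /b /= linearP.
  - by rewrite linearDl /= linearZl_LR.
  - by rewrite linearDr /= linearZr_LR.
pose bM := bilinear_isBilinear.Build C U W (tensor U W) _ _ b b_bil.
pose bB : {bilinear U -> W -> tensor U W} := HB.pack b bM.
exact: (tensor_liftE bB).
Qed.

End Tensor.

Section TensorDot.
Variables (C : numClosedFieldType) (U W : vectType C).

(* The induced inner product, computed on the expansions                      *)
(* t = \sum_i e_i (x) t_i of tens_sum; tensor_dotE characterises it.          *)
Definition tensor_dot (dotU : {inner U}) (dotW : {inner W})
    (s t : tensor U W) : C :=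
  \sum_i \sum_j dotU (basis_vec i) (basis_vec j)
                * dotW (tens_row i s) (tens_row j t).

Variables (dotU : {inner U}) (dotW : {inner W}).

Lemma tensor_dot_bilinear :
  bilinear_for (GRing.Scale.Law.clone _ _ *%R _)
    (GRing.Scale.Law.clone _ _ (Num.conj \; *%R) _) (tensor_dot dotU dotW).
Proof.
split=> [t|s] a x y; rewrite /tensor_dot /= mulr_sumr -big_split /=;
  apply: eq_bigr => i _; rewrite mulr_sumr -big_split /=;
  apply: eq_bigr => j _; rewrite linearP.
- by rewrite linearDl /= linearZl_LR mulrDr mulrCA.
- by rewrite linearDr /= linearZr_LR /= mulrDr mulrCA.
Qed.

HB.instance Definition _ :=
  bilinear_isBilinear.Build C (tensor U W) (tensor U W) C
    _ _ (tensor_dot dotU dotW) tensor_dot_bilinear.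

Lemma tensor_dotE u v w z :
  tensor_dot dotU dotW (tens u w) (tens v z) = dotU u v * dotW w z.
Proof.
rewrite /tensor_dot [u in RHS]vec_sum_coord linear_sumlz mulr_suml.
apply: eq_bigr => i _; rewrite [v in RHS]vec_sum_coord linear_sumr mulr_suml.
apply: eq_bigr => j _; rewrite !tens_rowE !linearZl_LR !linearZr_LR /=.
by rewrite mulrCA -!mulrA; congr (_ * _); rewrite mulrCA.
Qed.

Lemma tensor_dot_herm s t :
  tensor_dot dotU dotW s t
  = (-1) ^+ false * Num.conj (tensor_dot dotU dotW t s).
Proof.
rewrite expr0 mul1r /tensor_dot exchange_big rmorph_sum; apply: eq_bigr => i _.
rewrite rmorph_sum; apply: eq_bigr => j _ /=; rewrite rmorphM /=.
by rewrite hermC [dotW _ _]hermC /= expr0 !mul1r.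
Qed.

HB.instance Definition _ :=
  isHermitianSesquilinear.Build C (tensor U W) false Num.conj
    (tensor_dot dotU dotW) tensor_dot_herm.

Lemma orthogonal_basis (X : seq W) :
  exists2 S : seq W, pairwise_orthogonal dotW S & {subset X <= <<S>>%VS}.
Proof.
elim: X => [|x X [S oS XS]]; first by exists [::].
have [Y SY [Z [xE _ oZ]]] := orthogonal_split dotW S x.
have [Z0|Zn0] := eqVneq Z 0.
  exists S => // y; rewrite inE => /orP[/eqP->|/XS //].
  by rewrite xE Z0 addr0.
exists (Z :: S).
  rewrite -[Z :: S]/([:: Z] ++ S) pairwise_orthogonal_cat oS oZ.
  by rewrite /pairwise_orthogonal /= inE eq_sym Zn0.
move=> y; rewrite inE span_cons => /orP[/eqP->|/XS yS].
  by rewrite xE addrC memv_add ?memv_line.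
by apply: subvP yS; apply: addvSr.
Qed.

Lemma tensor_dot_gt0 t : t != 0 -> 0 < tensor_dot dotU dotW t t.
Proof.
move=> tn0.
have [S oS sS] := orthogonal_basis (vbasis {:W}).
have {}sS w : w \in <<S>>%VS.
  have : w \in {:W}%VS by rewrite memvf.
  by apply: subvP; rewrite -(span_basis (vbasisP {:W})); apply/span_subvP.
pose c i k := coord (in_tuple S) k (tens_row i t).
pose a k := \sum_i c i k *: basis_vec i : U.
have tE : t = \sum_k tens (a k) (in_tuple S)`_k.
  rewrite {1}[t]tens_sum.
  under eq_bigr => i _.
    rewrite [tens_row i t](@coord_span _ _ _ (in_tuple S)) // linear_sumr.
  over.
  rewrite exchange_big; apply: eq_bigr => k _ /=.
  rewrite /a linear_sumlz; apply: eq_bigr => i _.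
  by rewrite linearZl_LR linearZr_LR.
have [/= /andP[S0 uS] oSS] := pairwise_orthogonalP oS.
have dE : tensor_dot dotU dotW t t
    = \sum_(k < size S) dotU (a k) (a k) * dotW S`_k S`_k.
  rewrite {1}tE linear_sumlz; apply: eq_bigr => k _.
  rewrite tE linear_sumr (bigD1 k) //= tensor_dotE big1 ?addr0 // => l nlk.
  rewrite tensor_dotE oSS ?mulr0 ?mem_nth // nth_uniq //.
  by rewrite eq_sym -val_eqE in nlk *.
have [k ak] : exists k, a k != 0.
  apply/existsP; apply: contraNT tn0 => /existsPn a0.
  apply/eqP; rewrite tE big1 // => k _.
  by have /negbNE/eqP-> := a0 k; rewrite linear0l.
have Sk (l : 'I_(size S)) : S`_l != 0.
  by apply: contraNneq S0 => <-; apply: mem_nth.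
rewrite dE (bigD1 k) //= ltr_wpDr ?mulr_gt0 ?dnorm_gt0 //.
by apply: sumr_ge0 => l _; rewrite mulr_ge0 ?dnorm_ge0.
Qed.

HB.instance Definition _ :=
  isDotProduct.Build C (tensor U W) (tensor_dot dotU dotW) tensor_dot_gt0.

End TensorDot.

Section Operators.
Variables (C : numClosedFieldType) (V : vectType C) (dotV : {inner V}).

Definition unitary_op (f : 'End(V)) : Prop :=
  isometry dotV dotV f /\ limg f = fullv.

(* Idempotent whose range and kernel are orthogonal.                          *)
Definition orthogonal_projection (P : 'End(V)) : Prop :=
  (P \o P)%VF = P /\ {in limg P & lker P, forall x y, dotV x y = 0}.

Lemma orthogonal_projection_selfadjoint P :
  orthogonal_projection P <->
  (P \o P)%VF = P /\ forall x y, dotV (P x) y = dotV x (P y).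
Proof.
split=> -[PP oP]; split=> // x y.
  have PPE z : P (P z) = P z by rewrite -[in RHS]PP comp_lfunE.
  have ker z : z - P z \in lker P by rewrite memv_ker linearB /= PPE subrr.
  have img z : P z \in limg P by rewrite memv_img ?memvf.
  have E1 : dotV (P x) y = dotV (P x) (P y).
    by apply/eqP; rewrite -subr_eq0 -linearBr /= oP.
  have /(congr1 Num.conj) := oP _ _ (img y) (ker x).
  rewrite rmorph0 => h; rewrite E1; apply/esym/eqP.
  rewrite -subr_eq0 -linearBl /= hermC /= expr0 mul1r.
  exact/eqP.
move=> /memv_imgP[z _ ->]; rewrite memv_ker => /eqP Py.
by rewrite oP Py linear0r.
Qed.

End Operators.

Section Representation.
Variables (C : numClosedFieldType) (U : vectType C) (m : nat).
Variables (G : {group 'S_m}) (X : 'S_m -> 'End(U)).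

(* Only the values of X on G are constrained.  (t * s)%g is the composite of  *)
(* s after t as functions, see cart_permM.                                    *)
Definition unitary_rep (dotU : {inner U}) : Prop :=
  {in G, forall s, unitary_op dotU (X s)} /\
  {in G &, forall s t, X (t * s)%g = (X s \o X t)%VF}.

Definition irreducible_rep : Prop :=
  {:U}%VS != 0%VS /\
  forall W : {vspace U},
    {in G, forall s, (X s @: W <= W)%VS} -> W = 0%VS \/ W = fullv.

Definition gen_cart_symmetrizer (V : vectType C) :
    'End(tensor U {ffun 'I_m -> V}) :=
  (#|G|%:R)^-1 *: \sum_(s in G) tensor_map (X s) (cart_perm V s).

End Representation.

(* Main.v *)
Require Import Defs.
From mathcomp Require Import all_boot all_order all_fingroup all_algebra.
From mathcomp Require Import reals complex.
Import GRing.Theory Num.Theory.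
Local Open Scope ring_scope.

(** The operators [T s := X s (x) Q s], for [s] in [G], represent [G] by
    isometries of the tensor product, because [X] and [Q] represent it by
    isometries of the two factors ([cart_perm_isometry],
    [tensor_map_isometry]).  The symmetrizer is the average [P] of the [T s],
    so the theorem is an instance of the fact that the average of a finite
    group of isometries is the orthogonal projection onto the fixed vectors
    ([average_orthogonal_projection]).

    Indeed [T s \o P = P] for [s] in [G], since composing with [T s] permutes
    the terms of the average; averaging this over [s] gives [P \o P = P].
    Moreover, if [x] is fixed by [G] then [<x, y> = <T s x, T s y> =
    <x, T s y>] for all [s] in [G], hence [<x, y> = <x, P y>], which vanishes
    when [P y = 0]: range and kernel of [P] are orthogonal. *)

(** * Averaging a finite group of operators *)

Section Average.
Variables (C : numClosedFieldType) (V : vectType C).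
Variables (gT : finGroupType) (G : {group gT}) (T : gT -> 'End(V)).
Hypothesis TM : {in G &, forall s t, T (t * s)%g = (T s \o T t)%VF}.

Definition average : 'End(V) := (#|G|%:R)^-1 *: \sum_(s in G) T s.

Lemma averageE x : average x = (#|G|%:R)^-1 *: \sum_(s in G) T s x.
Proof. by rewrite scale_lfunE sum_lfunE. Qed.

Lemma average_const (W : lmodType C) (w : W) :
  (#|G|%:R)^-1 *: \sum_(s in G) w = w.
Proof.
by rewrite sumr_const -scaler_nat scalerA mulVf ?scale1r // pnatr_eq0 -lt0n.
Qed.

Lemma average_fixed s x : s \in G -> T s (average x) = average x.
Proof.
move=> sG; rewrite !averageE linearZ linear_sum /=; congr (_ *: _).
(* [T] reverses products, so [T s] acts on the terms by right translation. *)
rewrite [RHS](reindex_inj (mulIg s)) /=.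
apply: eq_big => [t|t tG]; first by rewrite groupMr.
by rewrite TM // comp_lfunE.
Qed.

Lemma average_idem : (average \o average)%VF = average.
Proof.
apply/lfunP => x; rewrite comp_lfunE [LHS]averageE.
under eq_bigr => s sG do rewrite average_fixed //.
exact: average_const.
Qed.

(** Isometries that fix [x] can be moved freely onto the other argument of
    [<x, y>], so averaging changes no inner product with a fixed vector; the
    range consists of fixed vectors and the average kills the kernel. *)
Lemma average_orthogonal_projection (dotV : {inner V}) :
  {in G, forall s, isometry dotV dotV (T s)} ->
  orthogonal_projection dotV average.
Proof.
move=> isoT; split=> [|_ y /memv_imgP[z _ ->]]; first exact: average_idem.
rewrite memv_ker => /eqP Py0.
have dot_fixed s : s \in G -> dotV (average z) (T s y) = dotV (average z) y.
  by move=> sG; rewrite -[in LHS](average_fixed s z sG) isoT.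
have := congr1 (dotV (average z)) Py0.
rewrite linear0r (averageE y) linearZr_LR linear_sumr /=.
(* The scalar leaves the second argument conjugated, but [1 / #|G|] is real. *)
rewrite (eq_bigr _ dot_fixed) rmorphV ?unitfE ?pnatr_eq0 -?lt0n //=.
by rewrite rmorph_nat [X in X = 0](average_const C^o).
Qed.

End Average.

(** * Isometries of Cartesian powers and tensor products *)

Lemma cart_perm_isometry (C : numClosedFieldType) (V : vectType C) (m : nat)
    (dotV : {inner V}) (s : 'S_m) :
  isometry (cart_dot dotV) (cart_dot dotV) (cart_perm V s).
Proof.
move=> x y; rewrite /cart_dot [RHS](reindex_inj (@perm_inj _ (s^-1)%g)) /=.
by apply: eq_bigr => i _; rewrite !cart_permE.
Qed.

Section TensorMap.
Variables (C : numClosedFieldType) (U W : vectType C).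

Lemma tensor_map_comp (f f' : 'End(U)) (g g' : 'End(W)) :
  tensor_map (f \o f')%VF (g \o g')%VF
  = (tensor_map f g \o tensor_map f' g')%VF.
Proof.
by apply: tensor_ext => u w; rewrite comp_lfunE !tensor_mapE !comp_lfunE.
Qed.

(** By sesquilinearity it is enough to compare inner products of pure tensors,
    and these factor. *)
Lemma tensor_map_isometry (dotU : {inner U}) (dotW : {inner W})
    (f : 'End(U)) (g : 'End(W)) :
  isometry dotU dotU f -> isometry dotW dotW g ->
  isometry (tensor_dot dotU dotW) (tensor_dot dotU dotW) (tensor_map f g).
Proof.
move=> isof isog s t; rewrite [s]tens_sum linear_sum 2!linear_sumlz.
apply: eq_bigr => i _; rewrite [t]tens_sum linear_sum.
rewrite [LHS]linear_sumr [RHS]linear_sumr; apply: eq_bigr => j _.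
by rewrite /= !tensor_mapE !tensor_dotE isof isog.
Qed.

End TensorMap.

(** * The generalized Cartesian symmetrizer *)

Theorem theorem1p1 (R : realType) (m : nat) (G : {group 'S_m})
    (V : vectType R[i]) (dotV : {inner V})
    (U : vectType R[i]) (dotU : {inner U})
    (X : 'S_m -> 'End(U)) :
  unitary_rep G X dotU ->
  irreducible_rep G X ->
  orthogonal_projection (tensor_dot dotU (cart_dot dotV))
    (gen_cart_symmetrizer G X V).
Proof.
move=> [unitX XM] _; apply: average_orthogonal_projection => [s t sG tG|s sG].
  by rewrite XM // cart_permM tensor_map_comp.
have [isoX _] := unitX s sG.
have isoQ := cart_perm_isometry _ V m dotV s.
exact: tensor_map_isometry _ _ _ _ _ _ _ isoX isoQ.
Qed.
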